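(* Let $\delta_1,\delta_2$ be real constants and let $\mu\in[0,2\pi)$ with $\mu\neq0,\pi$ and $\cos\mu\neq0$. Put $\kappa=2\arctan(\sin\mu\tan\delta_2)$ and $\tau=\log\frac{1-\sin\delta_1\cos\mu}{1+\sin\delta_1\cos\mu}$. The immersion and Gauss map of the stationary breather with Bäcklund parameter $\mu$ and associated family parameter $\lambda=e^t$, $t\in\mathbb{R}$, of the straight line are given by $$f_{breather}(k,\ell,\mu,t)=f_0(k,\ell,t)+2A\begin{bmatrix}\cos\mu\sinh t\,\operatorname{sech}(k\tau)\sin(\ell\kappa)\cos(\ell\kappa)-\sin\mu\cosh t\sinh(k\tau)\\ \operatorname{Im}\omega\,\sin(\ell\kappa)-\operatorname{Re}\omega\,(\cos\mu\sinh t\tanh(k\tau)\sin(\ell\kappa)+\sin\mu\cosh t\cos(\ell\kappa))\\ \operatorname{Im}\omega\,(\cos\mu\sinh t\tanh(k\tau)\sin(\ell\kappa)+\sin\mu\cosh t\cos(\ell\kappa))+\operatorname{Re}\omega\,\sin(\ell\kappa)\end{bmatrix}$$ and $$n_{breather}(k,\ell,\mu,t)=\frac{A}{2\cosh(k\tau)}\begin{bmatrix}4(\sin\mu\sinh t\cosh(k\tau)\cos(\ell\kappa)+\cos\mu\cosh t\sinh(k\tau)\sin(\ell\kappa))\\ \operatorname{Re}\omega\,\mathsf{B}-\operatorname{Im}\omega\,\mathsf{C}\\ -\operatorname{Re}\omega\,\mathsf{C}-\operatorname{Im}\omega\,\mathsf{B}\end{bmatrix},$$ where $$A=\frac{\sin(2\mu)\cosh(k\tau)}{(\cos(2\mu)+\cosh(2t))(\cos^2\mu\sin^2(\ell\kappa)+\cosh^2(k\tau)\sin^2\mu)},$$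 $$\mathsf{B}=2(\cos\mu\cosh t\sin(2\ell\kappa)-\sin\mu\sinh t\sinh(2k\tau)),$$ $$\mathsf{C}=\sin^2(\ell\kappa)\bigl(\sin(2\mu)+\cot\mu\,(\cosh(2t)+1)\bigr)-\cosh^2(k\tau)\bigl(\sin(2\mu)+\tan\mu\,(1-\cosh(2t))\bigr),$$ $f_0(k,\ell,t)=(-2x(k,\ell,t),0,0)$, and $$x(k,\ell,t)=k\,\frac{\cosh t\sin\delta_1}{1+\sinh^2t\sin^2\delta_1}+\ell\,\frac{\sinh t\sin\delta_2\cos\delta_2}{1+\sinh^2t\sin^2\delta_2},\qquad \omega(k,\ell,t)=\left(\frac{i+\sinh t\sin\delta_1}{i-\sinh t\sin\delta_1}\right)^k\left(\frac{i+\cosh t\tan\delta_2}{i-\cosh t\tan\delta_2}\right)^\ell.$$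
   Context: Quaternions: $\mathbb{H}$ is the real span of the $2\times2$ matrices $\mathbb{1},-i\sigma_1,-i\sigma_2,-i\sigma_3$, with Pauli matrices $\sigma_1=\begin{pmatrix}0&1\\1&0\end{pmatrix}$, $\sigma_2=\begin{pmatrix}0&-i\\i&0\end{pmatrix}$, $\sigma_3=\begin{pmatrix}1&0\\0&-1\end{pmatrix}$. $\mathbb{R}^3$ is identified with trace-free quaternions by $(x_1,x_2,x_3)\leftrightarrow\sum_jx_j(-i\sigma_j)$; $[X]^{\mathrm{tr}=0}$ is the trace-free part. For a map $g$ on $\mathbb{Z}^2$: $g=g(k,\ell)$, $g_1=g(k+1,\ell)$, $g_2=g(k,\ell+1)$ ($\delta_1,\delta_2$ are not shifts). Lax matrices: for a unitary vertex function $s$ and edge functions $l,m$ and spectral parameter $\lambda=e^t$, $$L=\begin{pmatrix}\cot\frac{\delta_1}2\frac{l}{s}+\tan\frac{\delta_1}2\,l s_1& i(\lambda-\frac{ss_1}{\lambda})\\ i(\lambda-\frac{1}{\lambda ss_1})&\cot\frac{\delta_1}2\frac{s}{l}+\tan\frac{\delta_1}2\frac{1}{l s_1}\end{pmatrix},\quad M=\begin{pmatrix}\cot\frac{\delta_2}2\frac{m}{s}+\tan\frac{\delta_2}2\,m s_2& i(\lambda-\frac{ss_2}{\lambda})\\ i(\lambda-\frac{1}{\lambda ss_2})&\cot\frac{\delta_2}2\frac{s}{m}+\tan\frac{\delta_2}2\frac{1}{m s_2}\end{pmatrix}.$$ The net with frame $\Phi$ ($\Phi_1=L\Phi$, $\Phi_2=M\Phi$)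 is $f=2[\Phi^{-1}\partial_t\Phi]^{\mathrm{tr}=0}$, $n=-i\Phi^{-1}\sigma_3\Phi$; varying $t$ gives its associated family. Straight line: the case $s_0(k,\ell)=l_0(k,\ell)=m_0(k,\ell)=(-1)^\ell$, with frame $\Phi_0$, $\Phi_0(0,0)=\mathbb{1}$; its net is $f_0=(-2x,0,0)$, $n_0=(0,\operatorname{Im}\omega,\operatorname{Re}\omega)$. Stationary breather with parameter $\mu$: the double Bäcklund transform of the straight line with parameters $\pm\alpha$, where $e^{i\mu}=\tan\frac\alpha2$ (so $\sin\alpha=1/\cos\mu$ and $\alpha$ is complex). Its frame is $B\Phi_0$ with $$B=\begin{pmatrix}s_b\bigl(e^{i\mu}s_{db}+\frac1{e^{i\mu}s_0}\bigr)& i\bigl(\lambda-\frac{s_{db}s_0}{\lambda}\bigr)\\ i\bigl(\lambda-\frac1{\lambda s_{db}s_0}\bigr)&\frac1{s_b}\bigl(\frac{e^{i\mu}}{s_{db}}+\frac{s_0}{e^{i\mu}}\bigr)\end{pmatrix},$$ where $s_b:\mathbb{Z}^2\to\mathbb{C}$ and the unitary function $s_{db}$, with $s_b(0,0)=i$, $s_{db}(0,0)=1$, are determined by the requirement that $B_1L=\tilde LB$, $B_2M=\tilde MB$ for all $\lambda$, with $L,M$ the Lax matrices of the straight line and $\tilde L,\tilde M$ the Lax matrices (same $\delta_1,\delta_2$) with vertex function $s_{db}$ and suitable edge functions $\tilde l,\tilde m$, i.e., writing $s_{db,1}=s_{db}(k+1,\ell)$ and $s_{db,2}=s_{db}(k,\ell+1)$,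 $$\tilde L=\begin{pmatrix}\cot\frac{\delta_1}2\frac{\tilde l}{s_{db}}+\tan\frac{\delta_1}2\,\tilde l s_{db,1}& i(\lambda-\frac{s_{db}s_{db,1}}{\lambda})\\ i(\lambda-\frac{1}{\lambda s_{db}s_{db,1}})&\cot\frac{\delta_1}2\frac{s_{db}}{\tilde l}+\tan\frac{\delta_1}2\frac{1}{\tilde l s_{db,1}}\end{pmatrix},\quad \tilde M=\begin{pmatrix}\cot\frac{\delta_2}2\frac{\tilde m}{s_{db}}+\tan\frac{\delta_2}2\,\tilde m s_{db,2}& i(\lambda-\frac{s_{db}s_{db,2}}{\lambda})\\ i(\lambda-\frac{1}{\lambda s_{db}s_{db,2}})&\cot\frac{\delta_2}2\frac{s_{db}}{\tilde m}+\tan\frac{\delta_2}2\frac{1}{\tilde m s_{db,2}}\end{pmatrix}.$$ Explicitly, $$s_b(k,\ell)=(-1)^\ell\Bigl(-1+\frac{2}{1-ie^{-(i\ell\kappa+k\tau)}}\Bigr),\qquad s_{db}(k,\ell)=(-1)^\ell\Bigl(-1+\frac{2}{1-i\cot\mu\operatorname{sech}(k\tau)\sin(\ell\kappa)}\Bigr).$$ Parameters $\delta_1,\delta_2$ are such that all expressions are defined (e.g. $\sin\delta_1\neq0$, $\sin\delta_2\cos\delta_2\ne0$). *)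

(* Defs.v *)
From mathcomp Require Export all_boot all_order all_algebra complex.
From mathcomp Require Export all_classical all_reals all_analysis.

Set Implicit Arguments.
Unset Strict Implicit.
Unset Printing Implicit Defensive.

Import Order.TTheory GRing.Theory Num.Theory.
Import numFieldNormedType.Exports.

Local Open Scope ring_scope.
Local Open Scope complex_scope.

Definition cosh (R : realType) (x : R) : R := (expR x + expR (- x)) / 2.
Definition sinh (R : realType) (x : R) : R := (expR x - expR (- x)) / 2.
Definition tanh (R : realType) (x : R) : R := sinh x / cosh x.
Definition sech (R : realType) (x : R) : R := (cosh x)^-1.
Definition cot (R : realType) (x : R) : R := cos x / sin x.

Definition mx22 (T : Type) (a b c d : T) : 'M[T]_2 :=
  \matrix_(i, j) if i == 0 then (if j == 0 then a else b)
                 else (if j == 0 then c else d).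

Definition vec3 (R : realType) (x1 x2 x3 : R) : 'cV[R]_3 :=
  \col_i [:: x1; x2; x3]`_i.

Definition sigma1 (R : realType) : 'M[R[i]]_2 := mx22 0 1 1 0.
Definition sigma2 (R : realType) : 'M[R[i]]_2 := mx22 0 (- 'i) 'i 0.
Definition sigma3 (R : realType) : 'M[R[i]]_2 := mx22 1 0 0 (- 1).

(* The identification of R^3 with the trace-free quaternions. *)
Definition quat_of_vec (R : realType) (x : 'cV[R]_3) : 'M[R[i]]_2 :=
  (x 0 0)%:C *: (- 'i *: sigma1 R) + (x 1 0)%:C *: (- 'i *: sigma2 R)
  + (x 2 0)%:C *: (- 'i *: sigma3 R).

(* [X]^{tr = 0} *)
Definition trfree (R : realType) (X : 'M[R[i]]_2) : 'M[R[i]]_2 :=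
  X - (\tr X / 2)%:M.

(* R[i] carries no normed R-module structure in the library, so the derivative
   of a matrix-valued function of a real variable is taken on the real and
   imaginary parts of its entries. *)
Definition derive_mx (R : realType) (F : R -> 'M[R[i]]_2) (t : R) :
    'M[R[i]]_2 :=
  \matrix_(i, j) (derive1 (fun u => complex.Re (F u i j)) t
                  +i* derive1 (fun u => complex.Im (F u i j)) t).

(* The common shape of the two Lax matrices: s is the vertex function at the
   source of the edge, s' at its target, e is the value on the edge. *)
Definition lax (R : realType) (delta : R) (s s' e lambda : R[i]) :
    'M[R[i]]_2 :=
  mx22 ((cot (delta / 2))%:C * (e / s) + (tan (delta / 2))%:C * (e * s'))
       ('i * (lambda - s * s' / lambda))
       ('i * (lambda - 1 / (lambda * s * s')))
       ((cot (delta / 2))%:C * (s / e) + (tan (delta / 2))%:C / (e * s')).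

Definition laxL (R : realType) (delta1 : R) (s l : int -> int -> R[i])
    (k ell : int) (lambda : R[i]) : 'M[R[i]]_2 :=
  lax delta1 (s k ell) (s (k + 1) ell) (l k ell) lambda.

Definition laxM (R : realType) (delta2 : R) (s m : int -> int -> R[i])
    (k ell : int) (lambda : R[i]) : 'M[R[i]]_2 :=
  lax delta2 (s k ell) (s k (ell + 1)) (m k ell) lambda.

Definition is_frame (R : realType) (delta1 delta2 : R)
    (s l m : int -> int -> R[i]) (Phi : int -> int -> R -> 'M[R[i]]_2) : Prop :=
  forall (k ell : int) (t : R),
    Phi (k + 1) ell t = laxL delta1 s l k ell (expR t)%:C *m Phi k ell t /\
    Phi k (ell + 1) t = laxM delta2 s m k ell (expR t)%:C *m Phi k ell t.

Definition immersion (R : realType) (Phi : int -> int -> R -> 'M[R[i]]_2)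
    (k ell : int) (t : R) : 'M[R[i]]_2 :=
  2 *: trfree (invmx (Phi k ell t) *m derive_mx (Phi k ell) t).

Definition gauss_map (R : realType) (Phi : int -> int -> R -> 'M[R[i]]_2)
    (k ell : int) (t : R) : 'M[R[i]]_2 :=
  - 'i *: (invmx (Phi k ell t) *m sigma3 R *m Phi k ell t).

(* The straight line is the case s = l = m = line. *)
Definition line (R : realType) (k ell : int) : R[i] := (- 1) ^ ell.

(* The double Baecklund matrix; expi is e^{i mu}. *)
Definition expi (R : realType) (mu : R) : R[i] := cos mu +i* sin mu.

Definition backlund (R : realType) (mu : R) (sb sdb : int -> int -> R[i])
    (k ell : int) (lambda : R[i]) : 'M[R[i]]_2 :=
  let s0 := line R k ell in
  let b := sb k ell in
  let d := sdb k ell in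
  mx22 (b * (expi mu * d + 1 / (expi mu * s0)))
       ('i * (lambda - d * s0 / lambda))
       ('i * (lambda - 1 / (lambda * d * s0)))
       (1 / b * (expi mu / d + s0 / expi mu)).

(* The conditions determining (s_b, s_db).  The nonvanishing of s_b and of the
   edge functions says that the matrices involved are defined. *)
Record breather_data (R : realType) (delta1 delta2 mu : R)
    (sb sdb : int -> int -> R[i]) : Prop := BreatherData {
  breather_sb00 : sb 0 0 = 'i;
  breather_sdb00 : sdb 0 0 = 1;
  breather_sb_neq0 : forall k ell, sb k ell != 0;
  breather_sdb_unitary : forall k ell, `|sdb k ell| = 1;
  breather_lax : exists lt mt : int -> int -> R[i],
    (forall k ell, lt k ell != 0 /\ mt k ell != 0) /\
    forall (k ell : int) (lambda : R[i]), lambda != 0 ->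
      backlund mu sb sdb (k + 1) ell lambda
        *m laxL delta1 (line R) (line R) k ell lambda =
      laxL delta1 sdb lt k ell lambda *m backlund mu sb sdb k ell lambda /\
      backlund mu sb sdb k (ell + 1) lambda
        *m laxM delta2 (line R) (line R) k ell lambda =
      laxM delta2 sdb mt k ell lambda *m backlund mu sb sdb k ell lambda }.

Definition breather_frame (R : realType) (mu : R) (sb sdb : int -> int -> R[i])
    (Phi0 : int -> int -> R -> 'M[R[i]]_2) (k ell : int) (t : R) :
    'M[R[i]]_2 :=
  backlund mu sb sdb k ell (expR t)%:C *m Phi0 k ell t.

(* Main.v *)
From mathcomp Require Import ring lra.
Require Import Defs.
Import Order.TTheory GRing.Theory Num.Theory.
Import numFieldNormedType.Exports.
Local Open Scope ring_scope.
Local Open Scope complex_scope.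

(** Every frame involved is a real quaternion, so both formulas reduce to
quaternion arithmetic once three facts are known.

The straight line.  All its Lax matrices are polynomials in [sigma1], hence
commute, and its frame is a product of factors [x + i y sigma1].  The
logarithmic derivative of such a product is the sum of those of the factors,
and conjugation by it rotates the plane of [sigma2], [sigma3] by the unit
complex number [(x - i y) / (x + i y)], which is multiplicative.  This gives
[x(k, l, t)] and [omega] ([line_frame_rotates]).

The vertex functions.  The determinant of the Baecklund matrix [B] is
[e^(2 i mu) + e^(-2 i mu) + lambda^2 + lambda^(-2)], so [B] is singular at
[lambda = i e^(i mu)] and at [lambda = i e^(- i mu)] (and at their opposites).
The intertwining relations make the Lax matrices of the line map the kernel at
one vertex onto the kernel at the next one, and since these Lax matrices have the common
eigenvectors [(1, 1)] and [(1, -1)] the kernels can be computed from the one at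
the origin: they are spanned by [(z - i, z + i)] with
[z = e^(k tau) e^(i l kappa)] or its conjugate ([backlund_kernel]).  Two kernels
determine [s_b] and [s_db].

The breather.  Write [K], [S] for the hyperbolic cosine and sine of [k tau],
[theta = l kappa], and [N = K sin mu + i cos mu sin theta].  With the values
found, [diag (conj N, N) B = 2 Q] for the quaternion
[Q = cos mu sin mu S + i (K sin mu sinh t sigma1 + cos mu sin theta cosh t sigma2
+ cos mu sin mu cos theta sigma3)] ([backlund_quat]).  The diagonal factor is
independent of [t] and commutes with [sigma3], so it affects neither the
immersion nor the Gauss map; these are read off from the frame [Q Phi0], that
is, from [Q^(-1) Q'] and [Q^(-1) sigma3 Q] rotated by [omega].  The denominator
of [A] is, up to a constant, the squared norm of [Q], which factors as
[(cos^2 mu + sinh^2 t) |N|^2]. *)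

Set Implicit Arguments.
Unset Strict Implicit.
Unset Printing Implicit Defensive.

Ltac complex_eq :=
  apply/eqP; rewrite eq_complex /=; apply/andP; split; apply/eqP.

(** * Matrices of size two and real quaternions *)

Lemma mx22P (T : Type) (a b c d a' b' c' d' : T) :
  a = a' -> b = b' -> c = c' -> d = d' -> mx22 a b c d = mx22 a' b' c' d'.
Proof. by move=> -> -> -> ->. Qed.

Lemma ord2P (i : 'I_2) : i = 0 \/ i = 1.
Proof. by case: i => [[|[|//]] ?]; [left|right]; apply/val_inj. Qed.

Lemma mulmx22 (T : comNzRingType) (a b c d a' b' c' d' : T) :
  mx22 a b c d *m mx22 a' b' c' d' =
  mx22 (a * a' + b * c') (a * b' + b * d') (c * a' + d * c') (c * b' + d * d').
Proof.
apply/matrixP => i j; rewrite !mxE big_ord_recl big_ord1 !mxE /=.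
by case: (i == 0); case: (j == 0).
Qed.

Lemma addmx22 (T : nmodType) (a b c d a' b' c' d' : T) :
  mx22 a b c d + mx22 a' b' c' d' = mx22 (a + a') (b + b') (c + c') (d + d').
Proof. by apply/matrixP => i j; rewrite !mxE; case: (i == 0); case: (j == 0). Qed.

Lemma scalemx22 (T : comNzRingType) (x a b c d : T) :
  x *: mx22 a b c d = mx22 (x * a) (x * b) (x * c) (x * d).
Proof. by apply/matrixP => i j; rewrite !mxE; case: (i == 0); case: (j == 0). Qed.

Lemma scalar_mx22 (T : comNzRingType) (x : T) : x%:M = mx22 x 0 0 x.
Proof. by apply/matrixP => i j; rewrite !mxE; case: (ord2P i) => ->; case: (ord2P j) => ->. Qed.

Lemma det_mx22 (T : comNzRingType) (a b c d : T) :
  \det (mx22 a b c d) = a * d - b * c.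
Proof. by rewrite (expand_det_row _ 0) big_ord_recl big_ord1 /cofactor !det_mx11 !mxE /=; ring. Qed.

(** The quaternion [a + i (b sigma1 + c sigma2 + d sigma3)].  The basis
[i sigma_j] is the opposite of the one used to identify vectors with trace-free
quaternions: it spares signs in the Lax matrices, and costs them in
[quat_of_vecE]. *)
Definition quat (R : realType) (a b c d : R) : 'M[R[i]]_2 :=
  mx22 (a +i* d) (c +i* b) (- c +i* b) (a -i* d).

Section Quat.
Variable R : realType.
Implicit Types a b c d : R.

Lemma quatM a b c d a' b' c' d' :
  quat a b c d *m quat a' b' c' d' =
  quat (a * a' - b * b' - c * c' - d * d')
       (a * b' + b * a' - (c * d' - d * c'))
       (a * c' + c * a' - (d * b' - b * d'))
       (a * d' + d * a' - (b * c' - c * b')).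
Proof.
by rewrite mulmx22; apply: mx22P; complex_eq; ring.
Qed.

Lemma det_quat a b c d :
  \det (quat a b c d) = (a ^+ 2 + b ^+ 2 + c ^+ 2 + d ^+ 2)%:C.
Proof.
by rewrite det_mx22; complex_eq; ring.
Qed.

Lemma quat_of_vecE (x : 'cV[R]_3) :
  quat_of_vec x = quat 0 (- x 0 0) (- x 1 0) (- x 2 0).
Proof.
rewrite /quat_of_vec /sigma1 /sigma2 /sigma3 !scalemx22 !addmx22.
by apply: mx22P; complex_eq; ring.
Qed.
End Quat.

(** * Differentiation entry by entry *)

Definition is_derive_mx (R : realType) (F : R -> 'M[R[i]]_2) (t : R)
    (F' : 'M[R[i]]_2) : Prop :=
  forall i j,
    is_derive t 1 (fun u => complex.Re (F u i j)) (complex.Re (F' i j)) /\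
    is_derive t 1 (fun u => complex.Im (F u i j)) (complex.Im (F' i j)).

Section DeriveMx.
Variable R : realType.

Lemma is_derive_mxE (F : R -> 'M[R[i]]_2) (t : R) (F' : 'M[R[i]]_2) : is_derive_mx F t F' -> derive_mx F t = F'.
Proof.
move=> dF; apply/matrixP => i j; rewrite mxE !derive1E.
by have [dRe dIm] := dF i j; rewrite !derive_val; case: (F' i j).
Qed.

Lemma is_derive_mxM (F G : R -> 'M[R[i]]_2) (t : R) (F' G' : 'M[R[i]]_2) :
  is_derive_mx F t F' -> is_derive_mx G t G' ->
  is_derive_mx (fun u => F u *m G u) t (F' *m G t + F t *m G').
Proof.
move=> dF dG i j.
have E (A B : 'M[R[i]]_2) : (A *m B) i j = A i 0 * B 0 j + A i 1 * B 1 j.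
  rewrite mxE big_ord_recl big_ord1 /=; congr (_ + A i _ * B _ j);
  by apply/val_inj.
have [dF0 dF0'] := dF i 0; have [dF1 dF1'] := dF i 1.
have [dG0 dG0'] := dG 0 j; have [dG1 dG1'] := dG 1 j.
have ReM (x y : R[i]) : complex.Re (x * y) =
  complex.Re x * complex.Re y - complex.Im x * complex.Im y.
  by case: x; case: y.
have ImM (x y : R[i]) : complex.Im (x * y) =
  complex.Re x * complex.Im y + complex.Im x * complex.Re y.
  by case: x; case: y.
have ReD (x y : R[i]) : complex.Re (x + y) = complex.Re x + complex.Re y.
  by case: x; case: y.
have ImD (x y : R[i]) : complex.Im (x + y) = complex.Im x + complex.Im y.
  by case: x; case: y.
split.
  rewrite (_ : (fun u => _) = fun u =>
    (complex.Re (F u i 0) * complex.Re (G u 0 j)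
     - complex.Im (F u i 0) * complex.Im (G u 0 j))
    + (complex.Re (F u i 1) * complex.Re (G u 1 j)
     - complex.Im (F u i 1) * complex.Im (G u 1 j))); last first.
    by apply/funext => u; rewrite E ReD !ReM.
  apply: is_derive_eq; rewrite mxE !E !ReD !ReM /GRing.scale /=; ring.
rewrite (_ : (fun u => _) = fun u =>
    (complex.Re (F u i 0) * complex.Im (G u 0 j)
     + complex.Im (F u i 0) * complex.Re (G u 0 j))
    + (complex.Re (F u i 1) * complex.Im (G u 1 j)
     + complex.Im (F u i 1) * complex.Re (G u 1 j))); last first.
  by apply/funext => u; rewrite E ImD !ImM.
apply: is_derive_eq; rewrite mxE !E !ImD !ImM /GRing.scale /=; ring.
Qed.

Lemma is_derive_mx_cst (A : 'M[R[i]]_2) (t : R) : is_derive_mx (fun=> A) t 0.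
Proof. by move=> i j; rewrite mxE; split; exact: is_derive_cst. Qed.

Lemma is_derive_mx_quat (a b c d : R -> R) (t a' b' c' d' : R) :
  is_derive t 1 a a' -> is_derive t 1 b b' ->
  is_derive t 1 c c' -> is_derive t 1 d d' ->
  is_derive_mx (fun u => quat (a u) (b u) (c u) (d u)) t (quat a' b' c' d').
Proof.
move=> da db dc dd i j.
have E (f g : R -> R) f' : f =1 g -> is_derive t 1 f f' -> is_derive t 1 g f'.
  by move=> /funext ->.
case: (ord2P i) => ->; case: (ord2P j) => ->; rewrite !mxE /=; split;
  first [ by apply: (E a) => // u; rewrite !mxE
        | by apply: (E b) => // u; rewrite !mxE
        | by apply: (E c) => // u; rewrite !mxE
        | by apply: (E d) => // u; rewrite !mxE
        | by apply: (E (fun u => - c u)) => // u; rewrite !mxE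
        | by apply: (E (fun u => - d u)) => // u; rewrite !mxE ].
Qed.
End DeriveMx.

(** * The Lax matrices of the straight line *)

Section Line.
Variable R : realType.

Lemma cosh2_sinh2 (x : R) : cosh x ^+ 2 = 1 + sinh x ^+ 2.
Proof.
have e1 : expR x * expR (- x) = 1 by rewrite -expRD subrr expR0.
rewrite /cosh /sinh.
transitivity (expR x * expR (- x) + ((expR x - expR (- x)) / 2) ^+ 2).
  by field.
by rewrite e1.
Qed.

Lemma cosh_gt0 (x : R) : 0 < cosh x.
Proof. by rewrite /cosh divr_gt0 // addr_gt0 // expR_gt0. Qed.

Lemma is_derive_expRN (t : R) : is_derive t 1 (fun u => expR (- u)) (- expR (- t)).
Proof. by apply: is_derive_eq; rewrite mulrN1. Qed.

Lemma is_derive_sinh (t : R) : is_derive t 1 (@sinh R) (cosh t).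
Proof.
have ? := is_derive_expRN t.
rewrite (_ : @sinh R = fun u => (2^-1 : R) *: (expR u - expR (- u))); last first.
  by apply/funext => u; rewrite /sinh mulrC.
by apply: is_derive_eq; rewrite opprK /cosh mulrC.
Qed.

Lemma is_derive_cosh (t : R) : is_derive t 1 (@cosh R) (sinh t).
Proof.
have ? := is_derive_expRN t.
rewrite (_ : @cosh R = fun u => (2^-1 : R) *: (expR u + expR (- u))); last first.
  by apply/funext => u; rewrite /cosh mulrC.
by apply: is_derive_eq; rewrite /sinh mulrC.
Qed.

Lemma sin_half (x : R) : sin x = 2 * (sin (x / 2) * cos (x / 2)).
Proof.
have {1}-> : x = x / 2 *+ 2 by rewrite mulr2n -splitr.
by rewrite sin_mulr2n mulr_natl [cos _ * _]mulrC.
Qed.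

Lemma cos_half (x : R) : cos x = cos (x / 2) ^+ 2 - sin (x / 2) ^+ 2.
Proof.
have {1}-> : x = x / 2 *+ 2 by rewrite mulr2n -splitr.
by rewrite mulr2n cosD !expr2.
Qed.

Lemma cot_tan_half (x : R) : sin x != 0 ->
  [/\ cot (x / 2) * tan (x / 2) = 1,
      cot (x / 2) + tan (x / 2) = 2 / sin x &
      cot (x / 2) - tan (x / 2) = 2 * cos x / sin x].
Proof.
rewrite /cot /tan (sin_half x) (cos_half x); set s := sin _; set c := cos _ => h.
have s0 : s != 0 by apply: contraNneq h => ->; rewrite mul0r mulr0.
have c0 : c != 0 by apply: contraNneq h => ->; rewrite !mulr0.
have cs : c ^+ 2 + s ^+ 2 = 1 := cos2Dsin2 _.
split; try field; rewrite ?s0 ?c0 //.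
by rewrite -{1}cs; field; rewrite s0 c0.
Qed.

Lemma line_neq0 (k l : int) : line R k l != 0.
Proof. by rewrite expfz_neq0 // oppr_eq0 oner_eq0. Qed.

Lemma lineS (k l : int) : line R k (l + 1) = - line R k l.
Proof. by rewrite /line expfzDr ?oppr_eq0 ?oner_eq0 // expr1z mulrN1. Qed.

Lemma line_sqr (k l : int) : line R k l ^+ 2 = 1.
Proof.
by rewrite /line expr2 -exprzMl ?unitrN1 // mulrNN mulr1 exp1rz.
Qed.

(** The recursions on the lattice are all invertible, so a property propagates
from the origin in the four directions, including the negative ones. *)
Lemma lattice_ind (P : int -> int -> Prop) :
    P 0 0 ->
    (forall k l, P k l <-> P (k + 1) l) -> (forall k l, P k l <-> P k (l + 1)) ->
  forall k l, P k l.
Proof.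
move=> P0 PS1 PS2.
have iterZ (Q : int -> Prop) : Q 0 -> (forall k, Q k <-> Q (k + 1)) ->
    forall k, Q k.
  move=> Q0 QS; elim=> // n; first by rewrite -addn1 PoszD => /QS.
  by move=> Qn; apply/QS; rewrite -addn1 PoszD opprD addrNK.
by move=> k; apply: (iterZ (P k)) => //; move: k; apply: (iterZ (P^~ 0)).
Qed.

(** Along the first lattice direction the sign [line] is constant and along the
second one it alternates, whence the two cases. *)
Lemma lax_line_even (delta : R) (s lambda : R[i]) :
    s ^+ 2 = 1 -> sin delta != 0 -> lambda != 0 ->
  lax delta s s s lambda =
  mx22 (2 / sin delta)%:C ('i * (lambda - lambda^-1))
       ('i * (lambda - lambda^-1)) (2 / sin delta)%:C.
Proof.
move=> s2 /cot_tan_half[_ <- _] l0; rewrite rmorphD /=.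
have /orP[] : (s == 1) || (s == -1) by rewrite -sqrf_eq1 s2.
  by move=> /eqP->; apply: mx22P; field; rewrite ?l0.
by move=> /eqP->; apply: mx22P; field; rewrite ?l0 ?oppr_eq0 ?oner_eq0.
Qed.

Lemma lax_line_odd (delta : R) (s lambda : R[i]) :
    s ^+ 2 = 1 -> sin delta != 0 -> lambda != 0 ->
  lax delta s (- s) s lambda =
  mx22 (2 * cos delta / sin delta)%:C ('i * (lambda + lambda^-1))
       ('i * (lambda + lambda^-1)) (2 * cos delta / sin delta)%:C.
Proof.
move=> s2 /cot_tan_half[_ _ <-] l0; rewrite rmorphB /=.
have /orP[] : (s == 1) || (s == -1) by rewrite -sqrf_eq1 s2.
  by move=> /eqP->; apply: mx22P; field; rewrite ?l0.
by move=> /eqP->; apply: mx22P; field; rewrite ?l0 ?oppr_eq0 ?oner_eq0.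
Qed.

Lemma expR_sub_inv (t : R) : (expR t)%:C - ((expR t)%:C)^-1 = (2 * sinh t)%:C.
Proof. by rewrite -fmorphV -rmorphB -expRN /sinh mulrC divfK. Qed.

Lemma expR_add_inv (t : R) : (expR t)%:C + ((expR t)%:C)^-1 = (2 * cosh t)%:C.
Proof. by rewrite -fmorphV -rmorphD -expRN /cosh mulrC divfK. Qed.

Lemma expRC_neq0 (t : R) : (expR t)%:C != 0.
Proof. by rewrite fmorph_eq0 gt_eqF // expR_gt0. Qed.

Lemma laxL_line (delta : R) (k l : int) (t : R) : sin delta != 0 ->
  laxL delta (line R) (line R) k l (expR t)%:C = quat (2 / sin delta) (2 * sinh t) 0 0.
Proof.
move=> d0; rewrite /laxL lax_line_even ?line_sqr ?expRC_neq0 // expR_sub_inv.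
by apply: mx22P; complex_eq; ring.
Qed.

Lemma laxM_line (delta : R) (k l : int) (t : R) : sin delta != 0 ->
  laxM delta (line R) (line R) k l (expR t)%:C =
  quat (2 * cos delta / sin delta) (2 * cosh t) 0 0.
Proof.
move=> d0; rewrite /laxM lineS lax_line_odd ?line_sqr ?expRC_neq0 // expR_add_inv.
by apply: mx22P; complex_eq; ring.
Qed.

(** * The frame of the straight line *)

(** Polar data of a family of quaternions [x + i y sigma1]: [X] is the
[i sigma1]-component of its logarithmic derivative, i.e. the derivative of the
angle of [x + i y], and [w] is the number by which conjugation rotates the
plane of [sigma2], [sigma3].  On products they are additive and
multiplicative, respectively.  The real part [h] of the logarithmic derivative is left unspecified,
as taking trace-free parts kills it. *)
Definition rotates (F : R -> 'M[R[i]]_2) (X : R -> R) (w : R -> R[i]) : Prop :=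
  forall t, exists x y h, [/\ F t = quat x y 0 0,
    is_derive_mx F t (F t *m quat h (X t) 0 0),
    x ^+ 2 + y ^+ 2 != 0 & x -i* y = w t * (x +i* y)].

Lemma rotatesM F G X Y v w : rotates F X v -> rotates G Y w ->
  rotates (fun t => F t *m G t) (fun t => X t + Y t) (fun t => v t * w t).
Proof.
move=> rF rG t; have [x [y [h [Ft dF xy0 vE]]]] := rF t.
have [x' [y' [h' [Gt dG xy0' wE]]]] := rG t.
exists (x * x' - y * y'), (x * y' + y * x'), (h + h'); split.
- by rewrite Ft Gt quatM; congr quat; ring.
- have := is_derive_mxM dF dG; congr is_derive_mx.
  by rewrite Ft Gt !quatM addmx22; apply: mx22P; complex_eq; ring.
- have -> : (x * x' - y * y') ^+ 2 + (x * y' + y * x') ^+ 2 =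
     (x ^+ 2 + y ^+ 2) * (x' ^+ 2 + y' ^+ 2) by ring.
  by rewrite mulf_neq0.
- transitivity ((x -i* y) * (x' -i* y')).
    by complex_eq; ring.
  by rewrite vE wE mulrACA.
Qed.

Lemma rotates_quat (x y x' y' : R -> R) (X : R -> R) (w : R -> R[i]) :
  (forall t : R, [/\ is_derive t 1 x (x' t), is_derive t 1 y (y' t),
     x t ^+ 2 + y t ^+ 2 != 0,
     x t * y' t - y t * x' t = X t * (x t ^+ 2 + y t ^+ 2) &
     x t -i* y t = w t * (x t +i* y t)]) ->
  rotates (fun t => quat (x t) (y t) 0 0) X w.
Proof.
move=> H t; have [dx dy n0 XE wE] := H t.
exists (x t), (y t), ((x t * x' t + y t * y' t) / (x t ^+ 2 + y t ^+ 2)).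
split=> //.
have d0 : is_derive t 1 (fun _ : R => 0 : R) 0 by exact: is_derive_cst.
have := is_derive_mx_quat dx dy d0 d0.
congr is_derive_mx; rewrite quatM.
have {XE} -> : X t = (x t * y' t - y t * x' t) / (x t ^+ 2 + y t ^+ 2).
  by rewrite XE mulfK.
by congr quat; field.
Qed.

Section Step.
Variables (P : R) (Q Q' : R -> R).
Hypotheses (P0 : P != 0) (dQ : forall t : R, is_derive t 1 Q (Q' t)).

Let n (t : R) := P ^+ 2 + Q t ^+ 2.

Let n_neq0 t : n t != 0.
Proof. by rewrite gt_eqF // ltr_pwDl ?sqr_ge0 // exprn_even_gt0. Qed.

Lemma rotates_step : rotates (fun t => quat P (Q t) 0 0)
  (fun t => P * Q' t / n t) (fun t => (P -i* Q t) / (P +i* Q t)).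
Proof.
apply: (@rotates_quat (fun=> P) Q (fun=> 0) Q') => t.
split=> //; first exact: is_derive_cst.
- exact: n_neq0.
- by rewrite mulr0 subr0 divfK ?n_neq0.
- by rewrite divfK // eq_complex /= (negPf P0).
Qed.

Lemma rotates_stepV : rotates (fun t => quat (P / n t) (- Q t / n t) 0 0)
  (fun t => - (P * Q' t / n t)) (fun t => ((P -i* Q t) / (P +i* Q t))^-1).
Proof.
apply: (@rotates_quat _ _ (fun t => - P * (2 * Q t * Q' t) / n t ^+ 2)
  (fun t => (- Q' t * n t + Q t * (2 * Q t * Q' t)) / n t ^+ 2)) => t.
have dn : is_derive t 1 (fun t : R => (n t)^-1) (- n t ^- 2 * (2 * Q t * Q' t)).
  apply: is_deriveV; first exact: n_neq0.
  by apply: is_derive_eq; rewrite /GRing.scale /= add0r; ring.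
split.
- by apply: is_derive_eq; rewrite /GRing.scale /=; field; exact: n_neq0.
- by apply: is_derive_eq; rewrite /GRing.scale /=; field; exact: n_neq0.
- have -> : (P / n t) ^+ 2 + (- Q t / n t) ^+ 2 = (n t)^-1.
    by have := n_neq0 t; rewrite /n => h; field.
  by rewrite invr_eq0 n_neq0.
- by have := n_neq0 t; rewrite /n => h; field.
- have Z0 : P -i* Q t != 0 by rewrite eq_complex /= (negPf P0).
  have -> : P / n t +i* (- Q t / n t) = (P -i* Q t) * (n t)^-1%:C.
    by complex_eq; ring.
  rewrite invf_div mulrA divfK //.
  by complex_eq; ring.
Qed.

(** Equivalence rather than implication, so that it also moves backwards on the
lattice. *)
Lemma rotates_stepE F F1 X w :
  (forall t, F1 t = quat P (Q t) 0 0 *m F t) ->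
  rotates F X w <->
  rotates F1 (fun t => X t + P * Q' t / n t)
             (fun t => w t * ((P -i* Q t) / (P +i* Q t))).
Proof.
move=> FE; split=> rF.
  have := rotatesM rotates_step rF; congr rotates; apply/funext => t.
  - by rewrite FE.
  - by rewrite addrC.
  - by rewrite mulrC.
have Z0 t : (P -i* Q t) / (P +i* Q t) != 0.
  by rewrite mulf_neq0 ?invr_eq0 // eq_complex /= (negPf P0).
have := rotatesM rotates_stepV rF; congr rotates; apply/funext => t.
- rewrite FE mulmxA quatM.
  have -> : quat (P / n t * P - (- Q t / n t) * Q t - 0 * 0 - 0 * 0)
     (P / n t * Q t + - Q t / n t * P - (0 * 0 - 0 * 0))
     (P / n t * 0 + 0 * P - (0 * Q t - - Q t / n t * 0))
     (P / n t * 0 + 0 * P - (- Q t / n t * 0 - 0 * Q t)) = 1%:M.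
    rewrite scalar_mx22; have := n_neq0 t; rewrite /n => h.
    by apply: mx22P; complex_eq; field.
  by rewrite mul1mx.
- by rewrite addrCA addNr addr0.
- by rewrite mulrCA mulVf ?mulr1.
Qed.
End Step.

Section Frame.
Variables (delta1 delta2 : R) (Phi0 : int -> int -> R -> 'M[R[i]]_2).
Hypotheses (hdelta1 : sin delta1 != 0) (hdelta2 : sin delta2 * cos delta2 != 0).
Hypothesis hframe : is_frame delta1 delta2 (line R) (line R) (line R) Phi0.
Hypothesis hframe0 : forall t : R, Phi0 0 0 t = 1%:M.

Definition line_pos (k l : int) (t : R) : R :=
  k%:~R * (cosh t * sin delta1 / (1 + sinh t ^+ 2 * sin delta1 ^+ 2))
    + l%:~R * (sinh t * sin delta2 * cos delta2
                 / (1 + sinh t ^+ 2 * sin delta2 ^+ 2)).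

Definition line_rot (k l : int) (t : R) : R[i] :=
  (('i + (sinh t * sin delta1)%:C) / ('i - (sinh t * sin delta1)%:C)) ^ k
    * (('i + (cosh t * tan delta2)%:C) / ('i - (cosh t * tan delta2)%:C)) ^ l.

Lemma im1_neq0 (x : R) : 'i + x%:C != 0 /\ 'i - x%:C != 0.
Proof. by split; rewrite eq_complex /= ?oppr0 ?addr0 oner_eq0 andbF. Qed.

(** Multiplying numerator and denominator by [i] turns the rotation of a single
step into the form used in [omega]. *)
Lemma rot_factor (P Q x : R) : P != 0 -> Q = P * x ->
  (P -i* Q) / (P +i* Q) = ('i + x%:C) / ('i - x%:C).
Proof.
move=> P0 ->; have [_ n0] := im1_neq0 x.
have Z0 : P +i* (P * x) != 0 by rewrite eq_complex /= (negPf P0).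
apply/eqP; rewrite eqr_div //.
by rewrite eq_complex /=; apply/andP; split; apply/eqP; ring.
Qed.

Lemma line_frame_rotates k l : rotates (Phi0 k l) (line_pos k l) (line_rot k l).
Proof.
have s2 : sin delta2 != 0 by apply: contraNneq hdelta2 => ->; rewrite mul0r.
have c2 : cos delta2 != 0 by apply: contraNneq hdelta2 => ->; rewrite mulr0.
have rfac0 (x : R) : ('i + x%:C) / ('i - x%:C) \is a GRing.unit.
  by have [? ?] := im1_neq0 x; rewrite unitfE mulf_neq0 ?invr_eq0.
move: k l; apply: lattice_ind => [|k l|k l].
- have -> : Phi0 0 0 = fun=> quat 1 0 0 0.
    by apply/funext => t; rewrite hframe0 scalar_mx22 /quat !oppr0.
  apply: (@rotates_quat (fun=> 1) (fun=> 0) (fun=> 0) (fun=> 0)) => t.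
  split; try exact: is_derive_cst.
  + by rewrite expr0n addr0 expr1n oner_neq0.
  + by rewrite /line_pos !mul0r; ring.
  + by rewrite /line_rot !expr0z oppr0 !mul1r.
- have P0 : 2 / sin delta1 != 0 by rewrite mulf_neq0 ?invr_eq0 ?pnatr_eq0.
  have dQ (t : R) : is_derive t 1 (fun u => 2 * sinh u) (2 * cosh t).
    by have ? := is_derive_sinh t; apply: is_derive_eq; rewrite /GRing.scale /=; ring.
  have FE t : Phi0 (k + 1) l t = quat (2 / sin delta1) (2 * sinh t) 0 0 *m Phi0 k l t.
    by have [-> _] := hframe k l t; rewrite laxL_line.
  rewrite (rotates_stepE P0 dQ _ _ FE).
  suff [-> ->] : (fun t => line_pos k l t + 2 / sin delta1 * (2 * cosh t) /
         ((2 / sin delta1) ^+ 2 + (2 * sinh t) ^+ 2)) = line_pos (k + 1) l /\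
      (fun t => line_rot k l t * ((2 / sin delta1 -i* (2 * sinh t))
         / (2 / sin delta1 +i* (2 * sinh t)))) = line_rot (k + 1) l by [].
  split; apply/funext => t.
    have d0 : 1 + sinh t ^+ 2 * sin delta1 ^+ 2 != 0.
      by rewrite -exprMn gt_eqF // ltr_wpDr ?sqr_ge0.
    rewrite (_ : _ ^+ 2 + _ ^+ 2 =
      (2 / sin delta1) ^+ 2 * (1 + sinh t ^+ 2 * sin delta1 ^+ 2)).
      by rewrite /line_pos intrD; set b := l%:~R * _; field; rewrite exprMn d0 hdelta1.
    by field.
  rewrite /line_rot exprzDr // expr1z mulrAC.
  by rewrite (rot_factor (x := sinh t * sin delta1)) //; field.
have P0 : 2 * cos delta2 / sin delta2 != 0.
  by rewrite !mulf_neq0 ?invr_eq0 ?pnatr_eq0.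
have dQ (t : R) : is_derive t 1 (fun u => 2 * cosh u) (2 * sinh t).
  by have ? := is_derive_cosh t; apply: is_derive_eq; rewrite /GRing.scale /=; ring.
have FE t : Phi0 k (l + 1) t =
    quat (2 * cos delta2 / sin delta2) (2 * cosh t) 0 0 *m Phi0 k l t.
  by have [_ ->] := hframe k l t; rewrite laxM_line.
rewrite (rotates_stepE P0 dQ _ _ FE).
suff [-> ->] : (fun t => line_pos k l t + 2 * cos delta2 / sin delta2 * (2 * sinh t) /
       ((2 * cos delta2 / sin delta2) ^+ 2 + (2 * cosh t) ^+ 2)) = line_pos k (l + 1) /\
    (fun t => line_rot k l t * ((2 * cos delta2 / sin delta2 -i* (2 * cosh t))
       / (2 * cos delta2 / sin delta2 +i* (2 * cosh t)))) = line_rot k (l + 1) by [].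
split; apply/funext => t.
  have d0 : 1 + sinh t ^+ 2 * sin delta2 ^+ 2 != 0.
    by rewrite -exprMn gt_eqF // ltr_wpDr ?sqr_ge0.
  rewrite (_ : _ ^+ 2 + _ ^+ 2 =
    (2 / sin delta2) ^+ 2 * (1 + sinh t ^+ 2 * sin delta2 ^+ 2)).
    by rewrite /line_pos intrD; set a := k%:~R * _; field; rewrite exprMn d0 s2.
  by rewrite [in LHS]exprMn [(2 * cos _) ^+ 2]exprMn cos2sin2 [(2 * cosh t) ^+ 2]exprMn cosh2_sinh2; field.
rewrite /line_rot exprzDr // expr1z.
rewrite (rot_factor (x := cosh t * tan delta2)) ?mulrA //.
by rewrite /tan; field; rewrite c2 s2.
Qed.
End Frame.

End Line.


(** * Kernels of the Baecklund matrix *)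

Section Expi.
Variable R : realType.
Implicit Types x y a : R.

Lemma expi0 : expi (0 : R) = 1.
Proof. by rewrite /expi cos0 sin0. Qed.

Lemma expiD x y : expi (x + y) = expi x * expi y.
Proof. by rewrite /expi cosD sinD; complex_eq; ring. Qed.

Lemma expi_neq0 x : expi x != 0.
Proof.
apply/eqP => /eqP; rewrite eq_complex /= => /andP[/eqP c0 /eqP s0].
by have /eqP := cos2Dsin2 x; rewrite c0 s0 expr0n addr0 eq_sym oner_eq0.
Qed.

Lemma expiN x : expi (- x) = (expi x)^-1.
Proof.
by apply: (mulfI (expi_neq0 x)); rewrite -expiD subrr expi0 divff ?expi_neq0.
Qed.

(** [e^(i kappa)] is the Cayley transform of [tan (kappa / 2)]; this is where
[kappa = 2 arctan (sin mu tan delta2)] comes from. *)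
Lemma expi_2atan a : 1 +i* a = (1 -i* a) * expi (2 * atan a).
Proof.
have c0 : cos (atan a) != 0.
  by rewrite cos_atan invr_eq0 gt_eqF // sqrtr_gt0 ltr_pwDl // sqr_ge0.
have sE : sin (atan a) = a * cos (atan a).
  by rewrite -{2}[a]atanK /tan divfK.
have cs := cos2Dsin2 (atan a).
rewrite mulr_natl mulr2n expiD /expi sE; rewrite sE in cs.
set c := cos _ in c0 cs *.
have cE : c ^+ 2 * (1 + a ^+ 2) = 1 by rewrite -[RHS]cs; ring.
by complex_eq; rewrite -[LHS]mulr1 -[X in _ * X = _]cE; ring.
Qed.
End Expi.

Section Kernel.
Variable R : realType.

Lemma imV : 'i^-1 = - 'i :> R[i].
Proof.
have i0 : 'i != 0 :> R[i] by rewrite eq_complex /= oner_eq0 andbF.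
by apply: (mulfI i0); rewrite divff // mulrN -expr2 sqr_i opprK.
Qed.

Definition col2 (x y : R[i]) : 'cV[R[i]]_2 := \col_j if j == 0 then x else y.

Lemma mulmx22_col (a b c d x y : R[i]) :
  mx22 a b c d *m col2 x y = col2 (a * x + b * y) (c * x + d * y).
Proof.
apply/matrixP => i j; rewrite !mxE big_ord_recl big_ord1 !mxE /=.
by case: (i == 0).
Qed.

Lemma col2_eq0 (x y : R[i]) : col2 x y = 0 <-> x = 0 /\ y = 0.
Proof.
split=> [/matrixP E|[-> ->]]; first by have := E 0 0; have := E 1 0; rewrite !mxE.
by apply/matrixP => i j; rewrite !mxE; case: (i == 0).
Qed.

(** The combination of the eigenvectors [(1, 1)] and [(1, -1)] with coefficients
[z] and [- i].  Up to scale, a matrix [mx22 p q q p] multiplies [z] by the ratio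
[(p + q) / (p - q)] of its eigenvalues. *)
Definition kervec (z : R[i]) : 'cV[R[i]]_2 := col2 (z - 'i) (z + 'i).

Lemma kervec_step (p q z z' : R[i]) : (p + q) * z = (p - q) * z' ->
  mx22 p q q p *m kervec z = (p - q) *: kervec z'.
Proof.
move=> E; rewrite mulmx22_col; apply/matrixP => i j; rewrite !mxE.
by case: (i == 0); rewrite [RHS](mulrDr (p - q)) -E; ring.
Qed.

Lemma kernel_transport (A A1 L L1 : 'M[R[i]]_2) (v v1 : 'cV[R[i]]_2) (c : R[i]) :
  A1 *m L = L1 *m A -> L *m v = c *: v1 -> c != 0 -> L1 \in unitmx ->
  A *m v = 0 <-> A1 *m v1 = 0.
Proof.
move=> AL Lv c0 uL1; split=> [Av|A1v].
  apply: (scalerI c0); rewrite scaler0 scalemxAr -Lv mulmxA AL -mulmxA Av.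
  by rewrite mulmx0.
rewrite -[A](mulKmx uL1) -AL -mulmxA -[A1 *m L *m v]mulmxA Lv -scalemxAr A1v.
by rewrite scaler0 mulmx0.
Qed.

(** At the spectral value [i e^(i nu)] with [nu = mu] or [- mu] the Baecklund
matrix is singular; there the off-diagonal entries of the Lax matrices become
real in one lattice direction and imaginary in the other, which is why the
breather grows along the first direction and oscillates along the second. *)
Lemma ispec_neq0 (nu : R) : 'i * expi nu != 0.
Proof. by rewrite mulf_neq0 ?expi_neq0 // eq_complex /= oner_eq0 andbF. Qed.

Lemma ispecV (nu : R) : ('i * expi nu)^-1 = - 'i * expi (- nu).
Proof.
apply: (mulfI (ispec_neq0 nu)); rewrite divff ?ispec_neq0 // mulrACA -expiD.
by rewrite subrr expi0; complex_eq; ring.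
Qed.

Lemma ispec_sub (nu : R) :
  'i * ('i * expi nu - ('i * expi nu)^-1) = (- (2 * cos nu))%:C.
Proof. by rewrite ispecV /expi cosN sinN; complex_eq; ring. Qed.

Lemma ispec_add (nu : R) :
  'i * ('i * expi nu + ('i * expi nu)^-1) = 0 -i* (2 * sin nu).
Proof. by rewrite ispecV /expi cosN sinN; complex_eq; ring. Qed.

(** The determinant depends neither on the vertex nor on the edge functions, so
the unknown Lax matrices of the breather are invertible exactly where those of
the line are. *)
Lemma det_lax (delta : R) (s s' e lambda : R[i]) :
  sin delta != 0 -> s != 0 -> s' != 0 -> e != 0 -> lambda != 0 ->
  \det (lax delta s s' e lambda) =
  (cot (delta / 2) - tan (delta / 2))%:C ^+ 2 - ('i * (lambda + lambda^-1)) ^+ 2.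
Proof.
move=> /cot_tan_half[ct _ _] s0 s'0 e0 l0; rewrite det_mx22 rmorphB /=.
have {}ct : (cot (delta / 2))%:C * (tan (delta / 2))%:C = 1 by rewrite -rmorphM ct.
move: ct; set c := (cot _)%:C; set d := (tan _)%:C => ct.
have i2 : 'i * 'i = -1 :> R[i] by rewrite -expr2 sqr_i.
transitivity (c ^+ 2 + d ^+ 2 + (c * d) * (s * s' + (s * s')^-1)
  - ('i * 'i) * (lambda ^+ 2 + lambda ^- 2 - s * s' - (s * s')^-1)).
  by field; rewrite s0 s'0 e0 l0.
rewrite ct i2 exprMn sqr_i.
transitivity (c ^+ 2 + d ^+ 2 - 2 * (c * d) + 2 + (lambda ^+ 2 + lambda ^- 2)).
  by rewrite ct; field; rewrite s0 s'0 l0.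
by field.
Qed.

Lemma lax_unit (delta nu : R) (s s' e : R[i]) :
  sin delta != 0 -> s != 0 -> s' != 0 -> e != 0 -> sin nu != 0 ->
  lax delta s s' e ('i * expi nu) \in unitmx.
Proof.
move=> d0 s0 s'0 e0 nu0; rewrite unitmxE unitfE det_lax ?ispec_neq0 // ispec_add.
set c := cot _ - tan _; rewrite (_ : _ - _ = (c ^+ 2 + (2 * sin nu) ^+ 2)%:C); last first.
  by complex_eq; ring.
by rewrite fmorph_eq0 gt_eqF // ltr_wpDl ?sqr_ge0 // exprn_even_gt0 // mulf_neq0 ?pnatr_eq0.
Qed.
End Kernel.

(** * The vertex functions and the Baecklund matrix of the breather *)

Section Determination.
Variables (R : realType) (delta1 delta2 mu : R) (sb sdb : int -> int -> R[i]).
Hypotheses (hcosmu : cos mu != 0) (hsinmu : sin mu != 0).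
Hypotheses (hdelta1 : sin delta1 != 0) (hdelta2 : sin delta2 * cos delta2 != 0).
Hypothesis hbreather : breather_data delta1 delta2 mu sb sdb.

Let s2 : sin delta2 != 0.
Proof. by apply: contraNneq hdelta2 => ->; rewrite mul0r. Qed.

Let c2 : cos delta2 != 0.
Proof. by apply: contraNneq hdelta2 => ->; rewrite mulr0. Qed.

Let sdb_neq0 k l : sdb k l != 0.
Proof. by rewrite -normr_eq0 (breather_sdb_unitary hbreather) oner_eq0. Qed.

Let tau := ln ((1 - sin delta1 * cos mu) / (1 + sin delta1 * cos mu)).

(* This is what makes the argument of the logarithm in [tau] positive, and the
   eigenvalues of the Lax matrices along the first lattice direction nonzero at
   the singular spectral values. *)
Let sincos_lt1 : `|sin delta1 * cos mu| < 1.
Proof.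
rewrite -(@expr_lt1 _ 2) // real_normK ?num_real // exprMn (sin2cos2 delta1) (cos2sin2 mu).
have s20 : 0 < sin mu ^+ 2 by rewrite exprn_even_gt0.
have := sqr_ge0 (cos delta1).
have : sin mu ^+ 2 <= 1 by rewrite sin2cos2 gerBl sqr_ge0.
by move: (sin mu ^+ 2) (cos delta1 ^+ 2) s20 => b a b0 b1 a0; nra.
Qed.

Let expR_tau : (1 + sin delta1 * cos mu) * expR tau = 1 - sin delta1 * cos mu.
Proof.
have /ltr_normlP[l1 l2] := sincos_lt1.
have p1 : 0 < 1 - sin delta1 * cos mu by rewrite subr_gt0.
have p2 : 0 < 1 + sin delta1 * cos mu by rewrite -ltrBlDl sub0r ltrNl.
rewrite /tau lnK ?posrE ?divr_gt0 //.
by rewrite mulrC divfK // gt_eqF.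
Qed.

Definition lattice_exp (a b : R) (k l : int) : R[i] :=
  (expR (k%:~R * a))%:C * expi (l%:~R * b).

Lemma lattice_expS1 a b k l :
  lattice_exp a b (k + 1) l = (expR a)%:C * lattice_exp a b k l.
Proof.
by rewrite /lattice_exp intrD mulrDl mul1r addrC expRD rmorphM /= mulrA.
Qed.

Lemma lattice_expS2 a b k l :
  lattice_exp a b k (l + 1) = expi b * lattice_exp a b k l.
Proof. by rewrite /lattice_exp intrD mulrDl mul1r addrC expiD mulrCA. Qed.

(** The hypotheses on [nu] select [mu] and [- mu], modulo full turns: the two
values of [nu] give the two singular spectral values, with kernels whose
parameters [z] are complex conjugate. *)
Lemma backlund_kernel (nu : R) (k l : int) :
    cos nu = cos mu -> sin nu != 0 ->
  backlund mu sb sdb k l ('i * expi nu) *m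
    kervec (lattice_exp tau (- (2 * atan (sin nu * tan delta2))) k l) = 0.
Proof.
move=> cnu nu0; move: k l.
have [lt [mt [ltmt0 intertwine]]] := breather_lax hbreather.
apply: lattice_ind => [|k l|k l].
- rewrite /lattice_exp !mul0r expR0 expi0 mulr1 /backlund mulmx22_col.
  rewrite (breather_sb00 hbreather) (breather_sdb00 hbreather).
  rewrite /line expr0z !mul1r mulr1 !invr1 !mulr1.
  rewrite ispec_sub -expiN /expi cosN sinN cnu.
  by rewrite imV; apply/col2_eq0; split; complex_eq; ring.
- have [lt0 mt0] := ltmt0 k l.
  have [E _] := intertwine k l _ (ispec_neq0 nu).
  apply: (kernel_transport E); last exact: lax_unit.
    rewrite /laxL lax_line_even ?line_sqr ?ispec_neq0 // ispec_sub.
    rewrite lattice_expS1.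
    apply: kervec_step.
    rewrite mulrA; congr (_ * _).
    rewrite -rmorphB -rmorphD -rmorphM cnu; congr (_ %:C).
    apply: (mulfI hdelta1).
    transitivity (2 * ((1 + sin delta1 * cos mu) * expR tau)).
      by rewrite expR_tau; field.
    by field.
  rewrite -rmorphB fmorph_eq0 cnu opprK.
  rewrite (_ : _ + _ = 2 / sin delta1 * (1 + sin delta1 * cos mu)); last by field.
  have /ltr_normlP[l1 _] := sincos_lt1.
  rewrite !mulf_neq0 ?invr_eq0 ?pnatr_eq0 // gt_eqF //.
  by rewrite -ltrBlDl sub0r ltrNl.
- have [lt0 mt0] := ltmt0 k l.
  have [_ E] := intertwine k l _ (ispec_neq0 nu).
  apply: (kernel_transport E); last exact: lax_unit.
    rewrite /laxM lineS lax_line_odd ?line_sqr ?ispec_neq0 // ispec_add.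
    rewrite lattice_expS2.
    apply: kervec_step.
    rewrite mulrA; congr (_ * _).
    rewrite expiN.
    set a := sin nu * tan delta2.
    have E2 : 2 * sin nu = 2 * cos delta2 / sin delta2 * a.
      by rewrite /a /tan; field; rewrite c2 s2.
    apply: (canRL (mulfK (expi_neq0 _))); rewrite E2.
    transitivity ((2 * cos delta2 / sin delta2)%:C * ((1 -i* a) * expi (2 * atan a))).
      by rewrite mulrA; congr (_ * _); complex_eq; ring.
    by rewrite -expi_2atan; complex_eq; ring.
  by rewrite eq_complex /= subr0 !mulf_eq0 invr_eq0 pnatr_eq0 (negPf s2) (negPf c2).
Qed.

Section Solve.
Variables (k l : int).
Let kappa := 2 * atan (sin mu * tan delta2).
Let kt := k%:~R * tau.
Let lk := l%:~R * kappa.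
Let s : R[i] := line R k l.
Let b := sb k l.
Let d := sdb k l.
Let e := expi mu.
Let E := expR kt.

Let s_neq0 : s != 0. Proof. exact: line_neq0. Qed.
Let sV : s^-1 = s.
Proof. by apply: (mulfI s_neq0); rewrite -expr2 line_sqr divff. Qed.
Let e_neq0 : e != 0. Proof. exact: expi_neq0. Qed.
Let d_neq0 : d != 0. Proof. exact: sdb_neq0. Qed.
Let b_neq0 : b != 0. Proof. exact: (breather_sb_neq0 hbreather). Qed.

Let i2 : 'i * 'i = -1 :> R[i]. Proof. by rewrite -expr2 sqr_i. Qed.

Let ss : s * s = 1. Proof. by rewrite -expr2 line_sqr. Qed.

(** Both rows of the kernel equation at [i e^(- i mu)] have [b (z - i) - s (z + i)]
as a factor.  The cofactors [p = e d + s / e] and [q = e / d + s / e] do not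
vanish together, for that would force [e^(4 i mu) = 1]. *)
Lemma sb_kernel : b * (E%:C * expi lk - 'i) = s * (E%:C * expi lk + 'i).
Proof.
have := @backlund_kernel (- mu) k l (cosN _).
rewrite sinN oppr_eq0 => /(_ hsinmu); rewrite mulNr atanN mulrN opprK.
rewrite /backlund mulmx22_col -/kappa => /col2_eq0[].
rewrite /lattice_exp -/kt -/lk -/E -/s -/b -/d -/e expiN -/e.
rewrite !invfM !invrK sV imV !mul1r; set z := _ * expi lk => H1 H2.
have Hp : (e * d + s / e) * (b * (z - 'i) - s * (z + 'i)) = 0.
  by rewrite -[RHS]H1; ring: i2 ss.
have Hq : (e / d + s / e) * (b * (z - 'i) - s * (z + 'i)) = 0.
  rewrite -[RHS](mulr0 (- (b * s))) -H2.
  transitivity ((e / d + s / e) * ((s * s) * b * (z - 'i) - s * (b / b) * (z + 'i))).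
    by rewrite ss divff // mul1r mulr1.
  by ring: i2 ss.
apply/eqP; rewrite -subr_eq0; apply: contra_eqT Hp => X0.
(* If the common factor does not vanish, then [p = 0] is impossible. *)
rewrite mulf_neq0 //; apply: contraTneq isT => p0.
have q0 : e / d + s / e = 0 by apply: (mulIf X0); rewrite mul0r.
have E1 : e ^+ 2 * d = - s.
  by rewrite -[LHS]subr0 -(mulr0 e) -p0; field.
have E2 : e ^+ 2 = - (s * d).
  by rewrite -[LHS]subr0 -(mulr0 (e * d)) -q0; field; rewrite e_neq0.
have : (e ^+ 2) ^+ 2 == 1.
  by rewrite expr2 {1}E2 mulNr -mulrA [d * _]mulrC E1 mulrN opprK ss.
rewrite sqrf_eq1 !eq_complex /= oppr0 -andb_orl => /andP[_].
by rewrite [sin mu * _]mulrC -mulr2n mulrn_eq0 mulf_eq0 (negPf hcosmu) (negPf hsinmu).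
Qed.

Let K := cosh kt.
Let S := sinh kt.
Let N : R[i] := (K * sin mu) +i* (cos mu * sin lk).

Let E_K : 2 * E * K = E ^+ 2 + 1.
Proof. by rewrite /K /cosh -/E expRN -/E; field; rewrite gt_eqF ?expR_gt0. Qed.

Let E_S : 2 * E * S = E ^+ 2 - 1.
Proof. by rewrite /S /sinh -/E expRN -/E; field; rewrite gt_eqF ?expR_gt0. Qed.

Let E2_neq0 : (2 * E)%:C != 0.
Proof. by rewrite fmorph_eq0 mulf_neq0 ?pnatr_eq0 // gt_eqF ?expR_gt0. Qed.

Let z := E%:C * expi lk.
Let z' := E%:C * expi (- lk).

Let zz' : z * z' = (E ^+ 2)%:C.
Proof. by rewrite /z /z' mulrACA -expiD subrr expi0 mulr1 -rmorphM. Qed.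

Let zBz' : z - z' = 'i * (2 * E * sin lk)%:C.
Proof. by rewrite /z /z' /expi cosN sinN; complex_eq; ring. Qed.

Let zDz' : z + z' = (2 * E * cos lk)%:C.
Proof. by rewrite /z /z' /expi cosN sinN; complex_eq; ring. Qed.

(* The four products of [z - i], [z + i] with the conjugate factors: multiplying
   the kernel equations by them turns [z] into hyperbolic functions of [kt] and
   trigonometric functions of [lk]. *)
Let prod_mp : (z - 'i) * (z' + 'i) = (2 * E)%:C * (K - sin lk)%:C.
Proof.
transitivity (z * z' + 'i * (z - z') - 'i * 'i); first by ring.
by rewrite zz' zBz' mulrA i2 -rmorphM /= mulrBr E_K; complex_eq; ring.
Qed.

Let prod_pp : (z + 'i) * (z' + 'i) = (2 * E)%:C * (S +i* cos lk).
Proof.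
transitivity (z * z' + 'i * (z + z') + 'i * 'i); first by ring.
rewrite zz' zDz' i2 (_ : (2 * E)%:C * _ = (2 * E * S) +i* (2 * E * cos lk)).
  by rewrite E_S; complex_eq; ring.
by complex_eq; ring.
Qed.

Let prod_mm : (z - 'i) * (z' - 'i) = (2 * E)%:C * (S -i* cos lk).
Proof.
transitivity (z * z' - 'i * (z + z') + 'i * 'i); first by ring.
rewrite zz' zDz' i2 (_ : (2 * E)%:C * _ = (2 * E * S) -i* (2 * E * cos lk)).
  by rewrite E_S; complex_eq; ring.
by complex_eq; ring.
Qed.

Let prod_pm : (z + 'i) * (z' - 'i) = (2 * E)%:C * (K + sin lk)%:C.
Proof.
transitivity (z * z' - 'i * (z - z') - 'i * 'i); first by ring.
by rewrite zz' zBz' mulrA i2 -rmorphM /= mulrDr E_K; complex_eq; ring.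
Qed.

(** [s_b = s (S + i cos theta) / (K - sin theta) =
s (K + sin theta) / (S - i cos theta)].  The two forms agree because
[K^2 - sin^2 theta = S^2 + cos^2 theta]; stating both without quotients avoids
deciding where the denominators vanish. *)
Lemma sb_eq : b * (K - sin lk)%:C = s * (S +i* cos lk).
Proof.
apply: (mulfI E2_neq0).
by rewrite mulrCA -prod_mp mulrA sb_kernel -/z -mulrA prod_pp mulrCA.
Qed.

Lemma sb_eq' : b * (S -i* cos lk) = s * (K + sin lk)%:C.
Proof.
apply: (mulfI E2_neq0).
by rewrite mulrCA -prod_mm mulrA sb_kernel -/z -mulrA prod_pm mulrCA.
Qed.

(** The first row of the kernel equation at [i e^(i mu)], with [s_b] eliminated
by [sb_eq], is linear in [s_db]; since [b] can be cancelled, no further case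
distinction is needed. *)
Lemma sdb_eq : d * (K * sin mu -i* (cos mu * sin lk)) = s * N.
Proof.
have := backlund_kernel k l (erefl (cos mu)) hsinmu.
rewrite /backlund mulmx22_col -/kappa => /col2_eq0[+ _].
rewrite /lattice_exp mulrN -/kt -/lk -/E -/s -/b -/d -/e -/z'.
rewrite !invfM sV imV !mul1r => H.
have {}H : (e * d + s / e) * b * (z' - 'i) = (e + d * s / e) * (z' + 'i).
  apply/eqP; rewrite -subr_eq0 -[X in _ == X]H; apply/eqP; ring: i2 ss.
have {}H : (e * d + s / e) * (K + sin lk)%:C = (s * e + d / e) * (K - sin lk)%:C.
  apply: (mulfI b_neq0); apply: (mulfI E2_neq0).
  transitivity ((e * d + s / e) * b * (z' - 'i) * (z + 'i)).
    by rewrite -mulrA [(z' - _) * _]mulrC prod_pm; ring.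
  rewrite H -mulrA [(z' + _) * _]mulrC prod_pp.
  transitivity ((e + d * s / e) * (2 * E)%:C * s * (s * (S +i* cos lk))).
    by rewrite -[LHS]mulr1 -ss; ring.
  by rewrite -sb_eq; ring: ss.
apply: (mulfI (_ : 'i *+ 2 != 0)).
  by rewrite mulrn_eq0 /= eq_complex /= oner_eq0 andbF.
apply/eqP; rewrite -subr_eq0.
rewrite (_ : _ - _ = (e * d + s / e) * (K + sin lk)%:C - (s * e + d / e) * (K - sin lk)%:C); first by rewrite H subrr.

rewrite -[e^-1]expiN /e /expi cosN sinN /N.
case: (d) => d1 d2; case: (s) => s1 s2'.
complex_eq; ring.
Qed.

(** By [sdb_eq], [s_db s = N / conj N], so multiplying the rows by [conj N] and
[N] clears the denominators; in the diagonal entries [s_b] then only occurs in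
the combinations of [sb_eq] and [sb_eq']. *)
Lemma backlund_quat (t : R) :
  quat (K * sin mu) 0 0 (- (cos mu * sin lk))
    *m backlund mu sb sdb k l (expR t)%:C =
  quat (2 * (cos mu * sin mu * S)) (2 * (K * sin mu * sinh t))
       (2 * (cos mu * sin lk * cosh t)) (2 * (cos mu * sin mu * cos lk)).
Proof.
pose N' : R[i] := K * sin mu -i* (cos mu * sin lk).
have -> : quat (K * sin mu) 0 0 (- (cos mu * sin lk)) = mx22 N' 0 0 N.
  by rewrite /quat opprK oppr0.
have NE : N = s * (d * N') by rewrite sdb_eq mulrA ss mul1r.
have dN : N / d = s * N' by rewrite NE; field.
have lS := expR_sub_inv t; have lC := expR_add_inv t.
rewrite /backlund mulmx22 -/s -/b -/d -/e !mul0r !addr0 !add0r !invfM sV !mul1r.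
apply: mx22P.
- have -> : N' * (b * (e * d + e^-1 * s)) = s * b * (e * N + e^-1 * N').
    by rewrite NE; ring: ss.
  have -> : e * N + e^-1 * N' = (2 * (cos mu * sin mu))%:C * (K - sin lk)%:C.
    by rewrite -[e^-1]expiN /e /expi cosN sinN /N /N'; complex_eq; ring.
  rewrite [LHS](_ : _ = (2 * (cos mu * sin mu))%:C * (s * (b * (K - sin lk)%:C))); last by ring.
  rewrite sb_eq [s * (s * _)]mulrA ss mul1r.
  by complex_eq; ring.
- have -> : N' * ('i * ((expR t)%:C - d * s / (expR t)%:C)) =
     'i * ((expR t)%:C * N' - N / (expR t)%:C) by rewrite NE; ring.
  have -> : (expR t)%:C * N' - N / (expR t)%:C =
      (K * sin mu)%:C * ((expR t)%:C - ((expR t)%:C)^-1)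
      - 'i * (cos mu * sin lk)%:C * ((expR t)%:C + ((expR t)%:C)^-1).
    rewrite (_ : N = (K * sin mu)%:C + 'i * (cos mu * sin lk)%:C); last by complex_eq; ring.
    rewrite (_ : N' = (K * sin mu)%:C - 'i * (cos mu * sin lk)%:C); last by complex_eq; ring.
    by ring.
  by rewrite lS lC; complex_eq; ring.
- have -> : N * ('i * ((expR t)%:C - ((expR t)%:C)^-1 / d * s)) =
     'i * ((expR t)%:C * N - N' / (expR t)%:C).
    rewrite [LHS](_ : _ = 'i * ((expR t)%:C * N - N / d * s / (expR t)%:C)); last by ring.
    by rewrite dN; ring: ss.
  have -> : (expR t)%:C * N - N' / (expR t)%:C =
      (K * sin mu)%:C * ((expR t)%:C - ((expR t)%:C)^-1)
      + 'i * (cos mu * sin lk)%:C * ((expR t)%:C + ((expR t)%:C)^-1).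
    rewrite (_ : N = (K * sin mu)%:C + 'i * (cos mu * sin lk)%:C); last by complex_eq; ring.
    rewrite (_ : N' = (K * sin mu)%:C - 'i * (cos mu * sin lk)%:C); last by complex_eq; ring.
    by ring.
  by rewrite lS lC; complex_eq; ring.
- have -> : N * (b^-1 * (e / d + s / e)) = b^-1 * s * (e * N' + N / e).
    rewrite [LHS](_ : _ = b^-1 * (e * (N / d) + s * N / e)); last by ring.
    by rewrite dN; ring.
  have -> : e * N' + N / e = (2 * (cos mu * sin mu))%:C * (K + sin lk)%:C.
    by rewrite -[e^-1]expiN /e /expi cosN sinN /N /N'; complex_eq; ring.
  rewrite [LHS](_ : _ = (2 * (cos mu * sin mu))%:C * (b^-1 * (s * (K + sin lk)%:C))); last by ring.
  rewrite -sb_eq' mulKf //.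
  by complex_eq; ring.
Qed.
End Solve.
End Determination.

(** * The immersion and the Gauss map *)

Section Geometry.
Variable R : realType.

Lemma sin2x (x : R) : sin (2 * x) = 2 * (sin x * cos x).
Proof. by rewrite mulr_natl sin_mulr2n mulr_natl [cos _ * _]mulrC. Qed.

Lemma cos2x (x : R) : cos (2 * x) = 2 * cos x ^+ 2 - 1.
Proof. by rewrite mulr_natl cos_mulr2n mulr_natl. Qed.

Lemma sinh2x (x : R) : sinh (2 * x) = 2 * (sinh x * cosh x).
Proof. by rewrite /sinh /cosh mulr_natl mulr2n opprD !expRD; field. Qed.

Lemma cosh2x (x : R) : cosh (2 * x) = 1 + 2 * sinh x ^+ 2.
Proof.
have e1 : expR x * expR (- x) = 1 by rewrite -expRD subrr expR0.
transitivity (expR x * expR (- x) + 2 * sinh x ^+ 2); last by rewrite e1.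
by rewrite /sinh /cosh mulr_natl mulr2n opprD !expRD; field.
Qed.

Lemma trfree_quat (a b c d : R) : trfree (quat a b c d) = quat 0 b c d.
Proof.
rewrite /trfree /mxtrace big_ord_recl big_ord1 !mxE /=.
rewrite (_ : a +i* d + a -i* d = 2 * a%:C); last by complex_eq; ring.
rewrite mulrAC mulfV ?pnatr_eq0 // mul1r scalar_mx22 -scaleN1r scalemx22 addmx22.
by apply: mx22P; complex_eq; ring.
Qed.

(** Left division: the right factor is [conj q q' / |q|^2]. *)
Lemma quat_div (a b c d a' b' c' d' : R) (n := a ^+ 2 + b ^+ 2 + c ^+ 2 + d ^+ 2) :
  n != 0 ->
  quat a b c d *m
    quat ((a * a' + b * b' + c * c' + d * d') / n)
         ((a * b' - b * a' + (c * d' - d * c')) / n)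
         ((a * c' - c * a' + (d * b' - b * d')) / n)
         ((a * d' - d * a' + (b * c' - c * b')) / n) = quat a' b' c' d'.
Proof. by rewrite /n => n0; rewrite quatM; congr quat; field. Qed.

(** The rotation acts on the coordinates along [sigma2] and [sigma3]; the form of
the right-hand side, with [w] split in real and imaginary part, is the one in
which [omega] enters the formulas of the theorem. *)
Lemma quat_rot (x y h b c d : R) (w : R[i]) : x -i* y = w * (x +i* y) ->
  quat h b c d *m quat x y 0 0 = quat x y 0 0 *m
    quat h b (complex.Re w * c + complex.Im w * d)
             (complex.Re w * d - complex.Im w * c).
Proof.
case: w => re im /= [E1 E2]; rewrite !quatM; congr quat; try ring.
- rewrite [RHS](_ : _ = c * (re * x - im * y) + d * (re * y + im * x)); last by ring.
  by rewrite -E1 -E2; ring.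
- rewrite [RHS](_ : _ = d * (re * x - im * y) - c * (re * y + im * x)); last by ring.
  by rewrite -E1 -E2; ring.
Qed.

(** The immersion only depends on the logarithmic derivative of the frame; a frame
[C Q G] with constant [C] has the logarithmic derivative of [Q G]. *)
Lemma immersion_quat (Phi : int -> int -> R -> 'M[R[i]]_2) (k l : int) (t : R)
    (a b c d : R) :
  Phi k l t \in unitmx ->
  is_derive_mx (Phi k l) t (Phi k l t *m quat a b c d) ->
  immersion Phi k l t = quat 0 (2 * b) (2 * c) (2 * d).
Proof.
move=> uPhi /is_derive_mxE dPhi; rewrite /immersion dPhi mulKmx // trfree_quat.
by rewrite scalemx22; apply: mx22P; complex_eq; ring.
Qed.

Lemma gauss_map_quat (Phi : int -> int -> R -> 'M[R[i]]_2) (k l : int) (t : R)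
    (W : 'M[R[i]]_2) :
  Phi k l t \in unitmx ->
  quat 0 0 0 (- 1) *m Phi k l t = Phi k l t *m W -> gauss_map Phi k l t = W.
Proof.
move=> uPhi E; rewrite /gauss_map -[RHS](mulKmx uPhi) -E.
rewrite -mulmxA scalemxAr scalemxAl; congr (_ *m (_ *m _)).
by rewrite /sigma3 scalemx22; apply: mx22P; complex_eq; ring.
Qed.

Lemma comm_invmx (D J : 'M[R[i]]_2) : D \in unitmx -> D *m J = J *m D ->
  J *m invmx D = invmx D *m J.
Proof.
by move=> uD DJ; rewrite -[LHS](mulKmx uD) [D *m (J *m _)]mulmxA DJ mulmxK.
Qed.

(** The computation at one vertex: the straight line enters only through the polar
data [X], [w] of its frame, and the Baecklund matrix only through its quaternion
form [Q], up to the constant factor [D]. *)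
Section Breather.
Variables (delta1 delta2 mu : R) (sb sdb : int -> int -> R[i]).
Variable Phi0 : int -> int -> R -> 'M[R[i]]_2.
Variables (k l : int) (t X : R) (w : R[i]) (kt lk : R).
Hypotheses (hcosmu : cos mu != 0) (hsinmu : sin mu != 0).

Let D := quat (cosh kt * sin mu) 0 0 (- (cos mu * sin lk)).
Let Q u := quat (2 * (cos mu * sin mu * sinh kt)) (2 * (cosh kt * sin mu * sinh u))
       (2 * (cos mu * sin lk * cosh u)) (2 * (cos mu * sin mu * cos lk)).

Hypothesis hB : forall u, D *m backlund mu sb sdb k l (expR u)%:C = Q u.
Variables (x y h : R).
Hypothesis Phi0E : Phi0 k l t = quat x y 0 0.
Hypothesis dPhi0 : is_derive_mx (Phi0 k l) t (quat x y 0 0 *m quat h X 0 0).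
Hypotheses (n0 : x ^+ 2 + y ^+ 2 != 0) (wE : x -i* y = w * (x +i* y)).

Let uD : D \in unitmx.
Proof.
rewrite unitmxE unitfE det_quat fmorph_eq0 gt_eqF // !expr0n /= !addr0 ltr_pwDl ?sqr_ge0 //.
by rewrite exprn_even_gt0 // mulf_neq0 // gt_eqF // cosh_gt0.
Qed.

Let den := (cos mu ^+ 2 + sinh t ^+ 2) *
   (cos mu ^+ 2 * sin lk ^+ 2 + cosh kt ^+ 2 * sin mu ^+ 2).

Let den_gt0 : 0 < den.
Proof.
rewrite /den mulr_gt0 //; first by rewrite ltr_pwDl ?sqr_ge0 // exprn_even_gt0.
rewrite -!exprMn ltr_wpDl ?sqr_ge0 // exprn_even_gt0 // mulf_neq0 //.
by rewrite gt_eqF // cosh_gt0.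
Qed.

Let normQ : (2 * (cos mu * sin mu * sinh kt)) ^+ 2 +
   (2 * (cosh kt * sin mu * sinh t)) ^+ 2 +
   (2 * (cos mu * sin lk * cosh t)) ^+ 2 +
   (2 * (cos mu * sin mu * cos lk)) ^+ 2 = 4 * den.
Proof.
have S2 : sinh kt ^+ 2 = cosh kt ^+ 2 - 1 by rewrite cosh2_sinh2; ring.
have C2 := cosh2_sinh2 t; have cl2 := cos2sin2 lk; have sm2 := sin2cos2 mu.
rewrite /den; ring: S2 C2 cl2 sm2.
Qed.

Let PhiE u : breather_frame mu sb sdb Phi0 k l u = invmx D *m (Q u *m Phi0 k l u).
Proof. by rewrite /breather_frame -hB -!mulmxA mulKmx. Qed.

Let uPhi : breather_frame mu sb sdb Phi0 k l t \in unitmx.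
Proof.
rewrite PhiE !unitmx_mul unitmx_inv uD Phi0E !unitmxE !unitfE !det_quat normQ.
by rewrite !fmorph_eq0 !expr0n /= !addr0 n0 mulf_neq0 ?pnatr_eq0 // gt_eqF.
Qed.

(** The amplitude [A] once the double angles in it are expanded; the factors 2
of [sin (2 mu)] and of [cos (2 mu) + cosh (2 t)] cancel. *)
Definition breather_amp : R :=
  sin mu * cos mu * cosh kt / den.

Let dQ : is_derive_mx Q t (quat 0 (2 * (cosh kt * sin mu * cosh t))
  (2 * (cos mu * sin lk * sinh t)) 0).
Proof.
have ? := is_derive_sinh t; have ? := is_derive_cosh t.
apply: is_derive_mx_quat; apply: is_derive_eq; rewrite /GRing.scale /=; ring.
Qed.

Let f1 := cos mu * sinh t * sech kt * sin lk * cos lk - sin mu * cosh t * sinh kt.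
Let f2 := cos mu * sinh t * tanh kt * sin lk + sin mu * cosh t * cos lk.

(* The logarithmic derivative of [Q], up to its real part [g], which does not
   contribute to the immersion. *)
Let Q_log : exists g, quat 0 (2 * (cosh kt * sin mu * cosh t))
  (2 * (cos mu * sin lk * sinh t)) 0 =
  Q t *m quat g (- (breather_amp * f1)) (breather_amp * f2) (- (breather_amp * sin lk)).
Proof.
have d0 : 4 * den != 0 by rewrite mulf_neq0 ?pnatr_eq0 // gt_eqF.
have K0 : cosh kt != 0 by rewrite gt_eqF // cosh_gt0.
have dn0 : den != 0 by rewrite gt_eqF.
move: (@quat_div (2 * (cos mu * sin mu * sinh kt)) (2 * (cosh kt * sin mu * sinh t))
  (2 * (cos mu * sin lk * cosh t)) (2 * (cos mu * sin mu * cos lk))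
  0 (2 * (cosh kt * sin mu * cosh t)) (2 * (cos mu * sin lk * sinh t)) 0).
rewrite /= normQ => /(_ d0) <-; eexists; rewrite /Q; congr (_ *m _).
congr quat; rewrite /breather_amp /f1 /f2 /tanh /sech.
- by field; rewrite K0 dn0.
- by field; rewrite K0 dn0.
- rewrite (_ : _ - _ + (_ - _) = - (4 * (cosh kt * sin mu * cos mu * sin lk)) * (cosh t ^+ 2 - sinh t ^+ 2)).
    by rewrite cosh2_sinh2 addrK; field.
  by ring.
Qed.

Let sigma_conj : quat 0 0 0 (- 1) *m Q t = Q t *m quat 0
   (- (breather_amp / (2 * cosh kt) * (4 * (sin mu * sinh t * cosh kt * cos lk
            + cos mu * cosh t * sinh kt * sin lk))))
   (- (breather_amp / (2 * cosh kt) * (2 * (cos mu * cosh t * sin (2 * lk)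
                - sin mu * sinh t * sinh (2 * kt)))))
   (breather_amp / (2 * cosh kt) * (sin lk ^+ 2 * (sin (2 * mu) + cot mu * (cosh (2 * t) + 1))
    - cosh kt ^+ 2 * (sin (2 * mu) + tan mu * (1 - cosh (2 * t))))).
Proof.
have d0 : 4 * den != 0 by rewrite mulf_neq0 ?pnatr_eq0 // gt_eqF.
have K0 : cosh kt != 0 by rewrite gt_eqF // cosh_gt0.
have dn0 : den != 0 by rewrite gt_eqF.
rewrite {1}/Q quatM.
rewrite -(@quat_div (2 * (cos mu * sin mu * sinh kt)) (2 * (cosh kt * sin mu * sinh t))
  (2 * (cos mu * sin lk * cosh t)) (2 * (cos mu * sin mu * cos lk))); last by rewrite normQ.
rewrite normQ /Q; congr (_ *m _); congr quat.
- by field.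
- rewrite /breather_amp; by field; rewrite K0 dn0.
- by rewrite /breather_amp sin2x sinh2x; field; rewrite K0 dn0.
- rewrite [RHS](_ : _ = (sin lk ^+ 2 * cos mu ^+ 2 * (sin mu ^+ 2 + cosh t ^+ 2)
      - cosh kt ^+ 2 * sin mu ^+ 2 * (cos mu ^+ 2 - sinh t ^+ 2)) / den).
    have S2 : sinh kt ^+ 2 = cosh kt ^+ 2 - 1 by rewrite cosh2_sinh2; ring.
    have cl2 := cos2sin2 lk.
    by apply/eqP; rewrite eqr_div //; apply/eqP; ring: S2 cl2.
  rewrite /breather_amp sin2x cosh2x /cot /tan (cosh2_sinh2 t).
  by field; rewrite K0 dn0 hcosmu hsinmu.
Qed.

Lemma breather_immersion_gauss :
  let A := sin (2 * mu) * cosh kt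
    / ((cos (2 * mu) + cosh (2 * t))
       * (cos mu ^+ 2 * sin lk ^+ 2 + cosh kt ^+ 2 * sin mu ^+ 2)) in
  let B := 2 * (cos mu * cosh t * sin (2 * lk)
                - sin mu * sinh t * sinh (2 * kt)) in
  let C := sin lk ^+ 2 * (sin (2 * mu) + cot mu * (cosh (2 * t) + 1))
    - cosh kt ^+ 2 * (sin (2 * mu) + tan mu * (1 - cosh (2 * t))) in
  let re := complex.Re w in
  let im := complex.Im w in
  immersion (breather_frame mu sb sdb Phi0) k l t =
    quat_of_vec (vec3 (- 2 * X) 0 0 + (2 * A) *: vec3
      (cos mu * sinh t * sech kt * sin lk * cos lk
       - sin mu * cosh t * sinh kt)
      (im * sin lk
       - re * (cos mu * sinh t * tanh kt * sin lk
               + sin mu * cosh t * cos lk))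
      (im * (cos mu * sinh t * tanh kt * sin lk
             + sin mu * cosh t * cos lk)
       + re * sin lk)) /\
  gauss_map (breather_frame mu sb sdb Phi0) k l t =
    quat_of_vec ((A / (2 * cosh kt)) *: vec3
      (4 * (sin mu * sinh t * cosh kt * cos lk
            + cos mu * cosh t * sinh kt * sin lk))
      (re * B - im * C)
      (- re * C - im * B)).
Proof.
move=> A B C re im.
have AE : A = breather_amp.
  rewrite /A /breather_amp /den sin2x cos2x cosh2x.
  have := den_gt0; rewrite /den => /lt0r_neq0; rewrite mulf_eq0 => /norP[d1 d2].
  rewrite (_ : 2 * cos mu ^+ 2 - 1 + (1 + 2 * sinh t ^+ 2) = 2 * (cos mu ^+ 2 + sinh t ^+ 2)); last by ring.
  move: (_ + sinh t ^+ 2) (_ + cosh kt ^+ 2 * _) d1 d2 => D1 D2 d1 d2.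
  by field; rewrite d1 d2.
split.
  have [g Qg] := Q_log.
  rewrite (immersion_quat (a := g + h) (b := - (breather_amp * f1) + X)
    (c := re * (breather_amp * f2) + im * - (breather_amp * sin lk))
    (d := re * - (breather_amp * sin lk) - im * (breather_amp * f2))) //; last first.
    (* Leibniz rule, then every logarithmic derivative is moved to the right. *)
    have PhiEx : breather_frame mu sb sdb Phi0 k l =
        fun u => invmx D *m (Q u *m Phi0 k l u) by apply/funext => u; exact: PhiE.
    rewrite PhiEx.
    have := is_derive_mxM (is_derive_mx_cst (invmx D) t) (is_derive_mxM dQ dPhi0).
    congr is_derive_mx; rewrite mul0mx add0r -mulmxA; congr (_ *m _).
    rewrite Qg -!mulmxA -mulmxDr Phi0E (quat_rot _ _ _ _ wE) -mulmxDr.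
    congr (_ *m (_ *m _)); rewrite addmx22.
    by apply: mx22P; complex_eq; ring.
  rewrite AE quat_of_vecE !mxE /=; congr quat; rewrite /f1 /f2; ring.
apply: gauss_map_quat => //.
rewrite PhiE mulmxA comm_invmx //; last by rewrite /D !quatM; congr quat; ring.
rewrite -!mulmxA; congr (_ *m _); rewrite mulmxA sigma_conj -!mulmxA; congr (_ *m _).
rewrite Phi0E (quat_rot _ _ _ _ wE) AE; congr (_ *m _).
by rewrite quat_of_vecE !mxE /=; congr quat; rewrite /B /C /re /im; ring.
Qed.
End Breather.

End Geometry.

Theorem theorem2p15 (R : realType) (delta1 delta2 mu : R)
    (hmu : 0 <= mu < 2 * pi) (hmu0 : mu != 0) (hmupi : mu != pi)
    (hcosmu : cos mu != 0)
    (hdelta1 : sin delta1 != 0)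
    (hdelta2 : sin delta2 * cos delta2 != 0)
    (sb sdb : int -> int -> R[i])
    (hbreather : breather_data delta1 delta2 mu sb sdb)
    (Phi0 : int -> int -> R -> 'M[R[i]]_2)
    (hframe : is_frame delta1 delta2 (line R) (line R) (line R) Phi0)
    (hframe0 : forall t : R, Phi0 0 0 t = 1%:M)
    (k ell : int) (t : R) :
  let kappa := 2 * atan (sin mu * tan delta2) in
  let tau := ln ((1 - sin delta1 * cos mu) / (1 + sin delta1 * cos mu)) in
  let kt := k%:~R * tau in
  let lk := ell%:~R * kappa in
  let x := k%:~R * (cosh t * sin delta1 / (1 + sinh t ^+ 2 * sin delta1 ^+ 2))
    + ell%:~R * (sinh t * sin delta2 * cos delta2
                 / (1 + sinh t ^+ 2 * sin delta2 ^+ 2)) in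
  let omega : R[i] :=
    (('i + (sinh t * sin delta1)%:C) / ('i - (sinh t * sin delta1)%:C)) ^ k
    * (('i + (cosh t * tan delta2)%:C) / ('i - (cosh t * tan delta2)%:C)) ^ ell
    in
  let re := complex.Re omega in
  let im := complex.Im omega in
  let f0 := vec3 (- 2 * x) 0 0 in
  let A := sin (2 * mu) * cosh kt
    / ((cos (2 * mu) + cosh (2 * t))
       * (cos mu ^+ 2 * sin lk ^+ 2 + cosh kt ^+ 2 * sin mu ^+ 2)) in
  let B := 2 * (cos mu * cosh t * sin (2 * lk)
                - sin mu * sinh t * sinh (2 * kt)) in
  let C := sin lk ^+ 2 * (sin (2 * mu) + cot mu * (cosh (2 * t) + 1))
    - cosh kt ^+ 2 * (sin (2 * mu) + tan mu * (1 - cosh (2 * t))) in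
  immersion (breather_frame mu sb sdb Phi0) k ell t =
    quat_of_vec (f0 + (2 * A) *: vec3
      (cos mu * sinh t * sech kt * sin lk * cos lk
       - sin mu * cosh t * sinh kt)
      (im * sin lk
       - re * (cos mu * sinh t * tanh kt * sin lk
               + sin mu * cosh t * cos lk))
      (im * (cos mu * sinh t * tanh kt * sin lk
             + sin mu * cosh t * cos lk)
       + re * sin lk)) /\
  gauss_map (breather_frame mu sb sdb Phi0) k ell t =
    quat_of_vec ((A / (2 * cosh kt)) *: vec3
      (4 * (sin mu * sinh t * cosh kt * cos lk
            + cos mu * cosh t * sinh kt * sin lk))
      (re * B - im * C)
      (- re * C - im * B)).
Proof.
move=> kappa tau kt lk x omega re im f0 A B C.
have sinmu0 : sin mu != 0.
  have /andP[mu_ge0 mu_lt2pi] := hmu.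
  have mu_gt0 : 0 < mu by rewrite lt0r hmu0.
  have [mu_lt|mu_gt|mu_eq] := ltgtP mu pi; last by rewrite mu_eq eqxx in hmupi.
    by rewrite gt_eqF // sin_gt0_pi // mu_gt0.
  rewrite -(subrK pi mu) sinDpi oppr_eq0 gt_eqF // sin_gt0_pi // subr_gt0 mu_gt.
  by rewrite ltrBlDr -mulr2n -mulr_natl.
have [x0 [y0 [h [PhiE dPhi n0 wE]]]] :=
  line_frame_rotates hdelta1 hdelta2 hframe hframe0 k ell t.
rewrite PhiE in dPhi.
by apply: (breather_immersion_gauss hcosmu sinmu0 _ PhiE dPhi n0 wE) => u;
   apply: backlund_quat.
Qed.
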